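(* Let $\mathsf I\subseteq\mathbb Q_S$ be an $S$-adic interval, let $\Omega$ be the product of the unit balls in $\mathbb Q_p^3$ for $p\in S$, and let $\epsilon>0$. Then there exist a non-degenerate isotropic irrational quadratic form $\mathbf q$ on $\mathbb Q_S^3$, a constant $c>0$, and a sequence of $S$-times $\mathsf T_i\to\infty$ such that for all $i$ $$\mathbf N_{\mathsf I,\mathbf q,\Omega}(\mathsf T_i)>c\,\|\mathsf T_i\|\,(\log\|\mathsf T_i\|)^{1-\epsilon}.$$
   Context: $S=\{\infty\}\cup S_f$ with $S_f$ a finite set of odd primes; $\mathbb Q_\infty=\mathbb R$, $\mathbb Q_S=\prod_{p\in S}\mathbb Q_p$. $\mathbb Z_S=\{x\in\mathbb Q:|x|_p\le1\text{ for all primes }p\notin S\}$, embedded diagonally in $\mathbb Q_S$. Norms: $\|\cdot\|_\infty$ is Euclidean; for $p\in S_f$, $\|v\|_p=\max_i|v_i|_p$. A quadratic form on $\mathbb Q_S^n$ is a tuple $\mathbf q=(\mathbf q_p)_{p\in S}$ with $\mathbf q_p$ a quadratic form on $\mathbb Q_p^n$; it is non-degenerate (isotropic) if every $\mathbf q_p$ is. It is rational if there are a quadratic form $\mathbf q_0$ over $\mathbb Q$ and an invertible $(\lambda_p)_{p\in S}\in\mathbb Q_S$ with $\mathbf q_p=\lambda_p\mathbf q_0$ for all $p\in S$, and irrational otherwise. An $S$-time is $\mathsf T=(T_p)_{p\in S}$ with $T_p>0$ real and $T_p\in p^{\mathbb Z}$ for $p\in S_f$; $\|\mathsf T\|=\prod_{p\in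 S}T_p$; $\mathsf T_i\to\infty$ means every component tends to infinity. $\mathsf T\Omega=\{(z_pv_p)_{p\in S}: z_p\in\mathbb Q_p,\ |z_p|_p\le T_p,\ v_p\in\Omega_p\}$ where $\Omega=\prod_p\Omega_p$ and here $\Omega_p=\{v\in\mathbb Q_p^3:\|v\|_p\le1\}$. An $S$-adic interval is $\mathsf I=\prod_{p\in S}I_p$ with $I_p=a_p+p^{b_p}\mathbb Z_p$ ($a_p\in\mathbb Q_p$, $b_p\in\mathbb Z$) for $p\in S_f$ and $I_\infty\subset\mathbb R$ a bounded interval of positive length. $\mathbf N_{\mathsf I,\mathbf q,\Omega}(\mathsf T)=\#\{\mathbf v\in\mathbb Z_S^3\cap\mathsf T\Omega:\mathbf q_p(\mathbf v)\in I_p\ \forall p\in S\}$. *)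

(* Defs.v *)
From HB Require Import structures.
From mathcomp Require Import all_boot all_order all_algebra.
From mathcomp Require Import finmap.
From mathcomp Require Import boolp classical_sets functions cardinality.
From mathcomp Require Import reals topology normedtype sequences exp.

Set Implicit Arguments.
Unset Strict Implicit.
Unset Printing Implicit Defensive.
Import Order.TTheory GRing.Theory Num.Theory numFieldNormedType.Exports.
Local Open Scope classical_set_scope.
Local Open Scope ring_scope.

(* The absolute value |x|_p = p^(- v_p x) on the rationals.  Since [logn p] is
   zero when [p] is not prime, it is then the trivial absolute value, and the
   construction of [padic p] below needs no primality assumption. *)
Definition padic_abs (p : nat) (x : rat) : rat :=
  if x == 0 then 0
  else p%:R ^ ((logn p `|denq x|)%:Z - (logn p `|numq x|)%:Z).
Arguments padic_abs p%_N x%_R.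

Section PadicAbs.
Variable p : nat.
Local Notation abs := (padic_abs p).

Lemma padic_abs0 : abs 0 = 0. Proof. by rewrite /padic_abs eqxx. Qed.

Let logn_nprime m : ~~ prime p -> logn p m = 0%N.
Proof. by rewrite lognE => /negPf ->. Qed.

Lemma padic_abs_frac (a b : int) : a != 0 -> b != 0 ->
  abs (a%:~R / b%:~R) = p%:R ^ ((logn p `|b|)%:Z - (logn p `|a|)%:Z).
Proof.
move=> a0 b0.
have x0 : a%:~R / b%:~R != 0 :> rat.
  by rewrite mulf_neq0 ?invr_eq0 ?intr_eq0.
rewrite /padic_abs (negPf x0).
move: a0 b0 x0; case: divqP => [|k x k0]; first by rewrite eqxx.
rewrite !mulf_eq0 !negb_or => /andP[_ n0] /andP[_ d0] x0.
rewrite !abszM !lognM ?absz_gt0 // !PoszD.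
by congr (_ ^ _); rewrite opprD addrACA subrr add0r.
Qed.

Let p_unit : prime p -> (p%:R : rat) \is a GRing.unit.
Proof. by move=> /prime_gt0 p0; rewrite unitfE pnatr_eq0 -lt0n. Qed.

Lemma padic_absM : {morph abs : x y / x * y}.
Proof.
move=> x y; have [->|x0] := eqVneq x 0; first by rewrite mul0r !padic_abs0 mul0r.
have [->|y0] := eqVneq y 0; first by rewrite mulr0 !padic_abs0 mulr0.
rewrite -[x]divq_num_den -[y]divq_num_den mulf_div -!rmorphM /=.
have n0 z : z != 0 :> rat -> numq z != 0 by rewrite numq_eq0.
rewrite !padic_abs_frac ?mulf_neq0 ?n0 ?denq_neq0 //.
rewrite !abszM !lognM ?absz_gt0 ?n0 ?denq_neq0 //.
have [pp|np] := boolP (prime p); last by rewrite !logn_nprime // !expr0z mulr1.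
rewrite -expfzDr; last by rewrite -unitfE p_unit.
by congr (_ ^ _); rewrite !PoszD opprD addrACA.
Qed.

Lemma padic_abs1 : abs 1 = 1.
Proof.
have := @padic_abs_frac 1 1; rewrite divr1 => -> //.
by rewrite subrr expr0z.
Qed.

Lemma padic_absN x : abs (- x) = abs x.
Proof. by rewrite /padic_abs oppr_eq0 numqN denqN abszN. Qed.

Lemma padic_abs_ge0 x : 0 <= abs x.
Proof. by rewrite /padic_abs; case: ifP => // _; rewrite exprz_ge0 ?ler0n. Qed.

Lemma padic_abs_eq0 x : (abs x == 0) = (x == 0).
Proof.
have [->|x0] := eqVneq x 0; first by rewrite padic_abs0 eqxx.
apply/negbTE/eqP => h; have := padic_absM x x^-1.
by rewrite mulfV // padic_abs1 h mul0r => /eqP; rewrite oner_eq0.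
Qed.

Lemma padic_absV x : abs x^-1 = (abs x)^-1.
Proof.
have [->|x0] := eqVneq x 0; first by rewrite !(invr0, padic_abs0).
have h : abs x != 0 by rewrite padic_abs_eq0.
by apply: (mulfI h); rewrite -padic_absM !mulfV ?padic_abs1.
Qed.

Let padic_absDz (a b : int) :
  abs (a + b)%:~R <= Num.max (abs a%:~R) (abs b%:~R).
Proof.
have [->|a0] := eqVneq a 0; first by rewrite add0r le_max lexx orbT.
have [->|b0] := eqVneq b 0; first by rewrite addr0 le_max lexx.
have [->|ab0] := eqVneq (a + b) 0; first by rewrite padic_abs0 le_max padic_abs_ge0.
have absE c : c != 0 -> abs c%:~R = p%:R ^ (- (logn p `|c|)%:Z).
  by move=> c0; rewrite -[c%:~R]divr1 -[1]/(1%:~R) padic_abs_frac // logn1 sub0r.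
rewrite !absE //.
have [pp|np] := boolP (prime p); last by rewrite !logn_nprime // le_max lexx.
have p1 : 1 <= (p%:R : rat) by rewrite ler1n prime_gt0.
suff : (logn p `|a| <= logn p `|(a + b)%R|)%N || (logn p `|b| <= logn p `|(a + b)%R|)%N.
  by rewrite le_max => /orP[]h; apply/orP; [left|right];
     apply: ler_weXz2l => //; rewrite lerN2 lez_nat.
wlog: a b a0 b0 ab0 / (logn p `|a| <= logn p `|b|)%N.
  move=> H; have [/H ->//|/ltnW /H] := leqP (logn p `|a|) (logn p `|b|).
  by rewrite addrC orbC => ->.
move=> h; apply/orP; left; rewrite -pfactor_dvdn ?absz_gt0 //.
have da : ((p ^ logn p `|a|)%N %| a)%Z by rewrite dvdzE pfactor_dvdnn.
have db : ((p ^ logn p `|a|)%N %| b)%Z.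
  by rewrite dvdzE pfactor_dvdn // absz_gt0.
by have := rpredD da db; rewrite dvdzE.
Qed.

Lemma padic_absD x y : abs (x + y) <= Num.max (abs x) (abs y).
Proof.
have dx : (denq x)%:~R != 0 :> rat by rewrite intr_eq0 denq_neq0.
have dy : (denq y)%:~R != 0 :> rat by rewrite intr_eq0 denq_neq0.
rewrite -[x in leLHS]divq_num_den -[y in leLHS]divq_num_den addf_div //.
rewrite -!rmorphM -rmorphD /= padic_absM padic_absV.
rewrite ler_pdivrMr; last by rewrite lt_neqAle padic_abs_ge0 eq_sym padic_abs_eq0
  intr_eq0 mulf_neq0 ?denq_neq0.
apply: (le_trans (padic_absDz _ _)).
rewrite maxr_pMl ?padic_abs_ge0 // -!padic_absM.
by rewrite !rmorphM /= mulrA -numqE [_ * (_ * _)]mulrCA -numqE [X in Num.max _ (abs X)]mulrC.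
Qed.

Lemma padic_absB x y : abs (x - y) <= Num.max (abs x) (abs y).
Proof. by rewrite -(padic_absN y) padic_absD. Qed.

Lemma padic_absBC x y : abs (x - y) = abs (y - x).
Proof. by rewrite -padic_absN opprB. Qed.

End PadicAbs.

Definition padic_cauchy (p : nat) : {pred nat -> rat} := fun u =>
  `[< forall e : rat, 0 < e -> exists N, forall m n, (N <= m)%N -> (N <= n)%N ->
        padic_abs p (u m - u n) < e >].

Section PadicCauchy.
Variable p : nat.
Local Notation abs := (padic_abs p).

Lemma padic_cauchy_bounded u : u \in padic_cauchy p ->
  exists2 M, 0 < M & forall n, abs (u n) <= M.
Proof.
move=> /asboolP /(_ 1 ltr01) [N hN].
pose M := 1 + abs (u N) + \sum_(i < N) abs (u i).
have s0 : 0 <= \sum_(i < N) abs (u i) by apply: sumr_ge0 => i _; exact: padic_abs_ge0.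
have M0 : 0 < M by rewrite ltr_pwDl // ltr_pwDl ?padic_abs_ge0.
exists M => // n; have [nN|Nn] := ltnP n N.
  rewrite /M (bigD1 (Ordinal nN)) //= addrCA lerDl addr_ge0 //.
    by rewrite addr_ge0 ?padic_abs_ge0.
  by apply: sumr_ge0 => i _; exact: padic_abs_ge0.
rewrite -[u n](subrK (u N)) (le_trans (padic_absD _ _ _)) // ge_max.
have := ltW (hN n N Nn (leqnn _)).
have a0 := padic_abs_ge0 p (u N).
move=> h; apply/andP; split.
  by rewrite (le_trans h) // /M -addrA lerDl addr_ge0.
by rewrite /M -addrA addrCA lerDl addr_ge0.
Qed.

Fact padic_cauchy_subring : subring_closed (padic_cauchy p).
Proof.
split.
- apply/asboolP => e e0; exists 0%N => m n _ _.
  by rewrite /= subrr padic_abs0.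
- move=> u v /asboolP hu /asboolP hv; apply/asboolP => e e0.
  have [N hN] := hu e e0; have [M hM] := hv e e0.
  exists (maxn N M) => m n; rewrite !geq_max => /andP[Nm Mm] /andP[Nn Mn].
  have -> : (u - v) m - (u - v) n = (u m - u n) - (v m - v n).
    by rewrite [(u - v) m]/(u m - v m) [(u - v) n]/(u n - v n) !opprD addrACA.
  by rewrite (le_lt_trans (padic_absB _ _ _)) // gt_max hN // hM.
- move=> u v cu cv; have [A A0 hA] := padic_cauchy_bounded cu.
  have [B B0 hB] := padic_cauchy_bounded cv.
  move: cu cv => /asboolP hu /asboolP hv; apply/asboolP => e e0.
  have [N hN] := hu (e / B) (divr_gt0 e0 B0).
  have [M hM] := hv (e / A) (divr_gt0 e0 A0).
  exists (maxn N M) => m n; rewrite !geq_max => /andP[Nm Mm] /andP[Nn Mn].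
  have -> : (u * v) m - (u * v) n = (u m - u n) * v m + u n * (v m - v n).
    by rewrite [(u * v) m]/(u m * v m) [(u * v) n]/(u n * v n) mulrBl mulrBr addrA subrK.
  rewrite (le_lt_trans (padic_absD _ _ _)) // gt_max !padic_absM; apply/andP; split.
    apply: le_lt_trans (_ : abs (u m - u n) * B < e).
      by rewrite ler_wpM2l ?padic_abs_ge0.
    by rewrite -ltr_pdivlMr // hN.
  apply: le_lt_trans (_ : A * abs (v m - v n) < e).
    by rewrite ler_wpM2r ?padic_abs_ge0.
  by rewrite mulrC -ltr_pdivlMr // hM.
Qed.

HB.instance Definition _ :=
  GRing.isSubringClosed.Build (nat -> rat) (padic_cauchy p) padic_cauchy_subring.

Record padic_seq := PadicSeq {
  padic_seq_val :> nat -> rat;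
  padic_seqP : padic_seq_val \in padic_cauchy p }.

HB.instance Definition _ := [isSub for padic_seq_val].
HB.instance Definition _ := [Choice of padic_seq by <:].
HB.instance Definition _ := [SubChoice_isSubComNzRing of padic_seq by <:].

Definition padic_null : {pred padic_seq} := fun u =>
  `[< forall e : rat, 0 < e -> exists N, forall n, (N <= n)%N -> abs (u n) < e >].

Fact padic_null_ideal : idealr_closed padic_null.
Proof.
split.
- by apply/asboolP => e e0; exists 0%N => n _; rewrite /= padic_abs0.
- apply/asboolP => /(_ 1 ltr01) [N /(_ N (leqnn _))].
  by rewrite padic_abs1 ltxx.
- move=> a u v /asboolP hu /asboolP hv; apply/asboolP => e e0.
  have [A A0 hA] := padic_cauchy_bounded (padic_seqP a).
  have [N hN] := hu (e / A) (divr_gt0 e0 A0); have [M hM] := hv e e0.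
  exists (maxn N M) => n; rewrite geq_max => /andP[Nn Mn].
  rewrite (le_lt_trans (padic_absD _ _ _)) // gt_max hM // andbT padic_absM.
  apply: le_lt_trans (_ : A * abs (u n) < e).
    by rewrite ler_wpM2r ?padic_abs_ge0.
  by rewrite mulrC -ltr_pdivlMr // hN.
Qed.

HB.instance Definition _ :=
  isIdealr.Build padic_seq padic_null padic_null_ideal.

(* The completion of the rationals for |.|_p. *)
Definition padic := {ideal_quot padic_null}.

HB.instance Definition _ := GRing.ComNzRing.on padic.

Lemma padic_non_null (u : padic_seq) : u \notin padic_null ->
  exists2 d, 0 < d & exists N, forall n, (N <= n)%N -> d <= abs (u n).
Proof.
move=> /asboolPn /existsNP[d /not_implyP[d0 /forallNP hd]].
have /asboolP/(_ d d0)[N hN] := padic_seqP u.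
exists d => //; exists N => n Nn.
have /existsNP[m /not_implyP[Nm /negP]] := hd N; rewrite -leNgt => dm.
rewrite leNgt; apply/negP => un.
suff : abs (u m) < d by rewrite ltNge dm.
rewrite -[u m](subrK (u n)) (le_lt_trans (padic_absD _ _ _)) // gt_max un andbT.
exact: hN.
Qed.

Fact padic_seq_inv_cauchy (u : padic_seq) : u \notin padic_null ->
  (fun n => (u n)^-1) \in padic_cauchy p.
Proof.
move=> /padic_non_null[d d0 [N hN]]; apply/asboolP => e e0.
have [M hM] := asboolP _ (padic_seqP u) (e * (d * d)) (mulr_gt0 e0 (mulr_gt0 d0 d0)).
exists (maxn N M) => m n; rewrite !geq_max => /andP[Nm Mm] /andP[Nn Mn].
have am := lt_le_trans d0 (hN m Nm); have an := lt_le_trans d0 (hN n Nn).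
have um : u m != 0 by rewrite -(padic_abs_eq0 p) gt_eqF.
have un : u n != 0 by rewrite -(padic_abs_eq0 p) gt_eqF.
have -> : (u m)^-1 - (u n)^-1 = (u n - u m) / (u m * u n).
  by rewrite mulrBl invfM mulrCA mulfV // mulr1 mulrA mulfV // mul1r.
rewrite padic_absM padic_absV padic_absM ltr_pdivrMr ?mulr_gt0 //.
apply: lt_le_trans (hM n m Mn Mm) _.
by rewrite ler_wpM2l ?(ltW e0) // ler_pM ?(ltW d0) ?hN.
Qed.

Definition padic_seq_inv (u : padic_seq) : padic_seq :=
  match pselect (u \notin padic_null) with
  | left h => PadicSeq (padic_seq_inv_cauchy h)
  | right _ => 0
  end.

Definition padic_inv (x : padic) : padic := \pi_padic%qT (padic_seq_inv (repr x)).

Lemma padic_pi_eq (u v : padic_seq) :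
  (\pi_padic%qT u == \pi_padic%qT v) = (u - v \in padic_null).
Proof. by rewrite Quotient.idealrBE. Qed.

Lemma padic_repr_null (x : padic) : (repr x \in padic_null) = (x == 0).
Proof.
rewrite -[repr x in LHS]subr0 -padic_pi_eq reprK.
by rewrite (rmorph0 \pi_padic%qT).
Qed.

Fact padic_mulVf (x : padic) : x != 0 -> padic_inv x * x = 1.
Proof.
rewrite -padic_repr_null => xN; rewrite /padic_inv -[x in _ * x]reprK.
rewrite -(rmorphM \pi_padic%qT) -(rmorph1 \pi_padic%qT).
apply/eqP; rewrite padic_pi_eq /padic_seq_inv.
case: pselect => // h; have [d d0 [N hN]] := padic_non_null h.
apply/asboolP => e e0; exists N => n Nn.
have un : repr x n != 0.
  by rewrite -(padic_abs_eq0 p) gt_eqF // (lt_le_trans d0) ?hN.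
have -> : (PadicSeq (padic_seq_inv_cauchy h) * repr x - 1 : padic_seq) n =
    (repr x n)^-1 * repr x n - 1 by [].
by rewrite mulVf // subrr padic_abs0.
Qed.

Fact padic_inv0 : padic_inv 0 = 0.
Proof.
rewrite /padic_inv /padic_seq_inv; case: pselect => [h|_].
  by have := h; rewrite padic_repr_null eqxx.
by rewrite (rmorph0 \pi_padic%qT).
Qed.

HB.instance Definition _ :=
  GRing.ComNzRing_isField.Build padic padic_mulVf padic_inv0.

End PadicCauchy.

Section PadicNorm.
Variables (R : realType) (p : nat).

Definition padic_norm (x : padic p) : R :=
  lim ((fun n => ratr (padic_abs p (repr x n)) : R) @ \oo).

Lemma padic_abs_dist (x y : rat) :
  `|padic_abs p x - padic_abs p y| <= padic_abs p (x - y).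
Proof.
suff H (s t : rat) : padic_abs p s - padic_abs p t <= padic_abs p (s - t).
  by rewrite ler_norml H andbT lerNl opprB padic_absBC H.
rewrite lerBlDr -[s in leLHS](subrK t) (le_trans (padic_absD _ _ _)) //.
by rewrite ge_max lerDl lerDr !padic_abs_ge0.
Qed.

Lemma padic_seq_cvgn (u : padic_seq p) :
  cvgn (fun n => ratr (padic_abs p (u n)) : R).
Proof.
apply/cauchy_cvgP/cauchy_exP => e e0.
have [q] := rat_in_itvoo e0; rewrite in_itv /= ltr0q => /andP[q0 qe].
have [N hN] := asboolP _ (padic_seqP u) q q0.
exists (ratr (padic_abs p (u N))); exists N => // n /= Nn.
rewrite /ball /= -rmorphB -ratr_norm (le_lt_trans _ qe) // ler_rat.
by rewrite (le_trans (padic_abs_dist _ _)) // ltW // hN.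
Qed.

Lemma padic_norm_cvg (u : padic_seq p) :
  (fun n => ratr (padic_abs p (u n)) : R) @ \oo -->
  padic_norm (\pi_(padic p)%qT u).
Proof.
set w := repr (\pi_(padic p)%qT u).
pose f (t : padic_seq p) : nat -> R := fun n => ratr (padic_abs p (t n)).
suff H : f u \- f w @ \oo --> (0 : R).
  have -> : (fun n => ratr (padic_abs p (u n))) = (f u \- f w) \+ f w.
    by apply/funext => n; rewrite /= subrK.
  rewrite -[padic_norm _]add0r; apply: cvgD H _.
  exact: padic_seq_cvgn.
apply/cvgr0Pnorm_lt => e e0.
have [q] := rat_in_itvoo e0; rewrite in_itv /= ltr0q => /andP[q0 qe].
have : u - w \in @padic_null p by rewrite -padic_pi_eq reprK.
move=> /asboolP/(_ q q0)[N hN]; exists N => // n /= Nn.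
rewrite -rmorphB -ratr_norm (le_lt_trans _ qe) // ler_rat.
by rewrite (le_trans (padic_abs_dist _ _)) // ltW // hN.
Qed.

Fact padic_cst_cauchy (x : rat) : (fun _ => x) \in padic_cauchy p.
Proof.
by apply/asboolP => e e0; exists 0%N => m n _ _; rewrite subrr padic_abs0.
Qed.

Definition padic_cst (x : rat) : padic_seq p := PadicSeq (padic_cst_cauchy x).

Lemma padic_cst_int (z : int) : padic_cst z%:~R = z%:~R.
Proof.
have natE k : padic_cst k%:R = k%:R.
  elim: k => [|k IH]; first exact: val_inj.
  rewrite [in RHS]mulrSr -IH; apply/val_inj/funext => n.
  by rewrite /= mulrSr.
case: z => k; first exact: natE.
rewrite NegzE !rmorphN /= -[k.+1%:~R in RHS]natE.
by apply/val_inj/funext => n.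
Qed.

Lemma padic_intr_eq0 (z : int) : (z%:~R == 0 :> padic p) = (z == 0).
Proof.
have [->|z0] := eqVneq z 0; first by rewrite eqxx.
rewrite -(rmorph_int \pi_(padic p)%qT) -(rmorph0 \pi_(padic p)%qT) padic_pi_eq.
rewrite subr0 -padic_cst_int; apply/asboolP => /(_ (padic_abs p z%:~R)).
have z1 : padic_abs p z%:~R != 0 by rewrite padic_abs_eq0 intr_eq0.
by rewrite lt_neqAle eq_sym z1 padic_abs_ge0 => /(_ isT)[N /(_ N (leqnn _))]; rewrite /= ltxx.
Qed.

Lemma padic_ratr (x : rat) : ratr x = (\pi_(padic p)%qT (padic_cst x) : padic p).
Proof.
have d0 : (denq x)%:~R != 0 :> padic p by rewrite padic_intr_eq0 denq_neq0.
apply: (mulIf d0); rewrite /ratr mulfVK //.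
rewrite -!(rmorph_int \pi_(padic p)%qT) -rmorphM -!padic_cst_int.
congr (\pi_(padic p)%qT _); apply/val_inj/funext => n.
by rewrite /= numqE.
Qed.

Lemma padic_norm_ratr (x : rat) : padic_norm (ratr x) = ratr (padic_abs p x).
Proof.
rewrite padic_ratr -(cvg_lim _ (@padic_norm_cvg (padic_cst x))) //.
by apply: cvg_lim => //; exact: (@cvg_cst R (ratr (padic_abs p x)) nat \oo).
Qed.

End PadicNorm.

(* A quadratic form is given by its symmetric Gram matrix, which determines it
   and is determined by it over the fields used here, of characteristic 0. *)
Record quadratic_form (F : fieldType) (n : nat) := QuadraticForm {
  gram : 'M[F]_n;
  gram_sym : gram \is symmetricmx }.

Section QuadraticForm.
Variables (F : fieldType) (n : nat) (q : quadratic_form F n).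

Definition qf_bilin (u v : 'rV[F]_n) : F := (u *m gram q *m v^T) 0 0.

Definition qf_eval (v : 'rV[F]_n) : F := qf_bilin v v.

Definition qf_nondegenerate : Prop :=
  forall u, (forall v, qf_bilin u v = 0) -> u = 0.

Definition qf_isotropic : Prop := exists2 v, v != 0 & qf_eval v = 0.

End QuadraticForm.

Section SArithmetic.
Variables (R : realType) (Sf : {fset nat}).

(* [None] is the infinite place. *)
Definition place : Type := option Sf.

Definition completion (v : place) : fieldType :=
  if v is Some p then padic (fsval p) else R.

Definition place_abs (v : place) : completion v -> R :=
  match v with
  | None => fun x : R => `|x|
  | Some p => fun x : padic (fsval p) => padic_norm R x
  end.

Definition place_norm n (v : place) : 'rV[completion v]_n -> R :=
  match v with
  | None => fun x : 'rV[R]_n => Num.sqrt (\sum_i x 0 i ^+ 2)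
  | Some p => fun x : 'rV[padic (fsval p)]_n =>
                \big[Num.max/0]_i padic_norm R (x 0 i)
  end.

(* A quadratic form on Q_S^n, and a product of subsets of the Q_p^n. *)
Definition S_form n : Type := forall v : place, quadratic_form (completion v) n.
Definition S_box n : Type := forall v : place, set 'rV[completion v]_n.

Definition S_nondegenerate n (q : S_form n) : Prop :=
  forall v, qf_nondegenerate (q v).

Definition S_isotropic n (q : S_form n) : Prop := forall v, qf_isotropic (q v).

Definition S_rational n (q : S_form n) : Prop :=
  exists (q0 : quadratic_form rat n) (lambda : forall v, completion v),
    (forall v, lambda v != 0) /\
    (forall v, gram (q v) = lambda v *: map_mx ratr (gram q0)).

Definition S_integral (x : rat) : Prop :=
  forall l : nat, prime l -> l \notin Sf -> padic_abs l x <= 1.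

Definition S_time (T : place -> R) : Prop :=
  (forall v, 0 < T v) /\
  (forall p : Sf, exists k : int, T (Some p) = (fsval p)%:R ^ k).

Definition S_time_norm (T : place -> R) : R := \prod_(v : place) T v.

Definition unit_balls n : S_box n := fun v => [set x | place_norm x <= 1].

Definition dilate n (T : place -> R) (Omega : S_box n) : S_box n := fun v =>
  [set x | exists z w, [/\ place_abs z <= T v, Omega v w & x = z *: w]].

Definition S_interval_at (v : place) : set (completion v) -> Prop :=
  match v with
  | None => fun I : set R => exists (b1 b2 : bool) (x y : R),
      x < y /\ I = [set` Interval (BSide b1 x) (BSide b2 y)]
  | Some p => fun I : set (padic (fsval p)) => exists a (b : int),
      I = [set a + (fsval p)%:R ^ b * z | z in [set z | padic_norm R z <= 1]]
  end.

Definition S_interval (I : forall v, set (completion v)) : Prop :=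
  forall v, S_interval_at (I v).

(* The set counted here is finite, since the dilate of Omega is bounded when
   Omega is; [fset_set] sends infinite sets to the empty one. *)
Definition S_count n (I : forall v, set (completion v)) (q : S_form n)
    (Omega : S_box n) (T : place -> R) : nat :=
  #|` fset_set [set x : 'rV[rat]_n |
      (forall i, S_integral (x 0 i)) /\
      (forall v, let xv := map_mx ratr x : 'rV[completion v]_n in
         @dilate n T Omega v xv /\ I v (qf_eval (q v) xv))] |%fset.

End SArithmetic.

Arguments unit_balls R Sf n v _ : clear implicits.
Arguments dilate {R Sf n} T Omega v _.
Arguments place_abs {R Sf} v x.
Arguments place_norm {R Sf n} v x.

(* Main.v *)
(* For a rational a, the form a t^2 + 2 x y takes the value a at an integer point
   exactly when 2 x y = - a (t^2 - 1).  With t = 1 + 2 K s the right-hand side is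
   - 4 K a s (K s + 1), and splitting s = d v and K s + 1 = u m gives the solution
   x = d m, y = - 2 K a v u.  Each pair (d, m) with m prime to K d yields such a
   point, and there are at least (\sum_d phi d * (D^2 / d^2)) of them, of order
   D^2 ln D, in a ball of radius O(D^2).

   Take q_p = alpha_p t^2 + 2 x y with alpha_p in I_p.  At these points q_p takes
   the value alpha_p + (alpha_p - a) (t^2 - 1), which lies in I_p if p is finite and
   K is divisible by a high power of p, and also at the real place if alpha_oo is
   very close to a.  The exponents of the T_p, p finite, being fixed first, T_oo
   may be taken so large that ln^eps absorbs every constant.  By Baire's theorem
   some irrational alpha_oo is close enough to suitable rationals at every stage;
   its irrationality alone makes q irrational. *)
Require Import Defs.
From mathcomp Require Import all_boot all_order all_algebra.
From mathcomp Require Import finmap.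
From mathcomp Require Import boolp classical_sets functions cardinality.
From mathcomp Require Import reals topology normedtype sequences exp.
From mathcomp Require Import cyclic ring lra.

Set Implicit Arguments.
Unset Strict Implicit.
Unset Printing Implicit Defensive.
Import Order.TTheory GRing.Theory Num.Theory numFieldNormedType.Exports.
Local Open Scope classical_set_scope.
Local Open Scope ring_scope.

(** * Sums of Euler's totient *)

Lemma count_coprime_iota n q :
  count (coprime n) (iota 0 (n * q)) = (q * totient n)%N.
Proof.
have shift m : count (coprime n) (iota (n * m) n) = totient n.
  rewrite totient_count_coprime -sum1_count -[iota _ n]map_id.
  rewrite -{1}[(n * m)%N]addn0 iotaDl map_id big_map big_mkcond /=.
  rewrite /index_iota subn0; apply: eq_bigr => i _.
  by rewrite /coprime mulnC gcdnMDl; case: eqP.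
elim: q => [|q IHq]; first by rewrite muln0.
by rewrite mulnSr iotaD count_cat IHq add0n shift mulSnr.
Qed.

(** Prime factors of [k] are removed one at a time: multiplying an integer by a prime [p] multiplies
    its totient by [p - 1] or by [p]. *)
Lemma leq_totientMl k d : (0 < k)%N -> (totient d <= totient (k * d))%N.
Proof.
elim/ltn_ind: k => k IHk k0.
have [k1|k1] := leqP k 1%N.
  by rewrite (_ : k = 1%N) ?mul1n //; apply/eqP; rewrite eqn_leq k1.
have pp := pdiv_prime k1; set p := pdiv k in pp.
have pk : (p %| k)%N by exact: pdiv_dvd.
have kp0 : (0 < k %/ p)%N by rewrite divn_gt0 ?prime_gt0 // dvdn_leq.
apply: (leq_trans (IHk _ _ kp0)); first by rewrite ltn_Pdiv ?prime_gt1.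
rewrite -{2}(divnK pk) (mulnC _ p) -mulnA; move: (k %/ p * d)%N => m.
have [pm|npm] := boolP (p %| m)%N; last first.
  rewrite totient_coprime; last by rewrite prime_coprime.
  by rewrite leq_pmull // totient_gt0 prime_gt0.
suff -> : totient (p * m) = (p * totient m)%N by rewrite leq_pmull // prime_gt0.
have cop i : coprime (p * m) i = coprime m i.
  rewrite coprimeMl; have [cm|] := boolP (coprime m i); last by rewrite andbF.
  by rewrite (coprime_dvdl pm cm).
have := count_coprime_iota (p * m) 1; rewrite mul1n => <-.
by rewrite muln1 (eq_count cop) mulnC count_coprime_iota mulnC.
Qed.

Section TotientSums.
Variable R : realType.
Implicit Types (d n N D : nat).

Lemma ln_le_harmonic D : ln (D.+1%:R : R) <= \sum_(1 <= n < D.+1) n%:R^-1.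
Proof.
elim: D => [|D IHD]; first by rewrite big_geq // ln1.
rewrite big_nat_recr //=.
have D0 : 0 < D.+1%:R :> R by rewrite ltr0n.
have -> : D.+2%:R = D.+1%:R * (1 + D.+1%:R^-1) :> R.
  by rewrite mulrDr mulr1 divff ?gt_eqF // -natr1.
rewrite lnM ?posrE ?addr_gt0 ?invr_gt0 //; apply: lerD => //.
by apply: le_ln1Dx; rewrite (lt_trans (ltrN10 _)) // invr_gt0.
Qed.

Lemma sum_invsq_multiples_le d N : (0 < d)%N ->
  \sum_(1 <= n < N.+1 | (d %| n)%N) (n%:R ^- 2 : R) <= 2 * d%:R ^- 2.
Proof.
move=> d0; have dR : 0 < d%:R :> R by rewrite ltr0n.
(* The constant bound 2 does not survive the induction; 2 k / (k + 1) with k = [N %/ d] does. *)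
suff H : \sum_(1 <= n < N.+1 | (d %| n)%N) (n%:R ^- 2 : R) <=
    d%:R ^- 2 * (2 * (N %/ d)%:R / (N %/ d).+1%:R).
  apply: le_trans H _; rewrite mulrC ler_wpM2r ?invr_ge0 ?exprn_ge0 ?ler0n //.
  by rewrite ler_pdivrMr ?ltr0n // ler_wpM2l // ler_nat.
elim: N => [|N IHN].
  by rewrite big_geq // div0n mulr0 mul0r mulr0.
rewrite big_mkcond big_nat_recr //= -big_mkcond divnS //.
case: ifP => dN; last by rewrite addr0 add0n.
rewrite add1n; apply: (le_trans (lerD IHN (lexx _))).
have NE : N.+1 = ((N %/ d).+1 * d)%N by rewrite -{1}(divnK dN) divnS // dN.
rewrite NE natrM; set k := (N %/ d)%N.
rewrite exprMn (invfM (k.+1%:R ^+ 2)) [_ * d%:R ^- 2]mulrC -mulrDr.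
rewrite ler_wpM2l ?invr_ge0 ?exprn_ge0 ?ler0n //.
rewrite -(natr1 k) -(natr1 k.+1) -(natr1 k); have : 0 <= k%:R :> R by rewrite ler0n.
move: (k%:R : R) => x x0.
rewrite -subr_ge0.
have -> : 2 * (x + 1) / (x + 1 + 1) - (2 * x / (x + 1) + (x + 1) ^- 2) =
  x / ((x + 1) ^+ 2 * (x + 1 + 1)).
  by field; rewrite !gt_eqF //; lra.
by rewrite divr_ge0 // mulr_ge0 ?exprn_ge0 //; lra.
Qed.

(* From n = \sum_(d | n) phi d, one gets
   \sum_n 1/n = \sum_d phi d \sum_(d | n) 1/n^2 <= 2 \sum_d phi d / d^2. *)
Lemma ln_le_sum_totient D :
  ln (D.+1%:R : R) <= 2 * \sum_(1 <= d < D.+1) (totient d)%:R / d%:R ^+ 2.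
Proof.
apply: (le_trans (ln_le_harmonic D)).
have E n : (0 < n < D.+1)%N ->
    n%:R^-1 = \sum_(1 <= d < D.+1 | (d %| n)%N) (totient d)%:R / n%:R ^+ 2 :> R.
  move=> /andP[n0 nD].
  rewrite -mulr_suml -natr_sum.
  suff -> : (\sum_(1 <= d < D.+1 | d %| n) totient d)%N = n.
    by rewrite expr2 invfM mulrA divff ?mul1r // pnatr_eq0 -lt0n.
  rewrite -[RHS]sum_totient_dvd -(big_mkord (fun d => d %| n)%N totient).
  rewrite [RHS]big_ltn_cond //= dvd0n (gtn_eqF n0).
  rewrite (big_cat_nat (n := n.+1)) //=.
  rewrite [X in (_ + X)%N]big_nat_cond [X in (_ + X)%N]big1 ?addn0 // => i.
  by move=> /andP[/andP[ni _] /(dvdn_leq n0)]; rewrite leqNgt ni.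
rewrite (eq_big_nat _ _ E) (exchange_big_dep_nat xpredT) //= mulr_sumr.
rewrite ler_sum_nat // => d /andP[d0 _]; rewrite -mulr_sumr mulrCA.
by rewrite ler_wpM2l ?ler0n // sum_invsq_multiples_le.
Qed.

(** Two factors 1/2 are lost: one in [ln_le_sum_totient], one in the floor, since the integer part
    of x >= 1 is at least x / 2. *)
Lemma sum_totient_divn_ge D :
  D%:R ^+ 2 * ln D.+1%:R / 4 <=
  (\sum_(1 <= d < D.+1) totient d * (D ^ 2 %/ d ^ 2))%:R :> R.
Proof.
apply: (@le_trans _ _ (D%:R ^+ 2 / 2 *
    \sum_(1 <= d < D.+1) (totient d)%:R / d%:R ^+ 2)).
  have -> : D%:R ^+ 2 * ln D.+1%:R / 4 = D%:R ^+ 2 / 4 * ln (D.+1%:R : R).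
    by rewrite mulrAC.
  apply: le_trans (ler_wpM2l _ (ln_le_sum_totient D)) _.
    by rewrite divr_ge0 ?exprn_ge0 ?ler0n.
  by rewrite mulrA -[X in _ <= X * _]mulr1 -subr_ge0 -mulrBl mulr_ge0 //; [lra|
     rewrite sumr_ge0 // => i _; rewrite divr_ge0 ?exprn_ge0 ?ler0n].
rewrite mulr_sumr natr_sum ler_sum_nat // => d /andP[d0 dD].
rewrite natrM mulrCA ler_wpM2l ?ler0n //.
have d2 : (0 < d ^ 2)%N by rewrite expn_gt0 d0.
rewrite mulrAC -natrX -natrX ler_pdivrMr // ler_pdivrMr ?ltr0n // -!natrM ler_nat.
have q1 : (0 < D ^ 2 %/ d ^ 2)%N by rewrite divn_gt0 // leq_exp2r // -ltnS.
rewrite (leq_trans (ltnW (ltn_ceil (D ^ 2) d2))) // leq_mul2r.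
by rewrite muln2 -addnn -[X in (X < _)%N]add0n ltn_add2r q1 orbT.
Qed.

End TotientSums.

(** * Integral points on a t^2 + 2 x y = a *)

Section IntegralPoints.
Variables (K : nat) (c : int).
Hypothesis K_gt1 : (1 < K)%N.

(** The range of [m] consists of whole periods modulo [K * d], so its coprime members are counted
    exactly; its length keeps [d * m] at most [K * D ^ 2]. *)
Definition point_pairs D : seq (nat * nat) :=
  [seq (d, m) | d <- iota 1 D,
     m <- [seq m <- iota 0 (K * d * (D ^ 2 %/ d ^ 2)) | coprime (K * d) m]].

(* Here c stands for 2 K a, and u m - v K d = 1. *)
Definition integral_point (dm : nat * nat) : 'rV[int]_3 :=
  let: (d, m) := dm in let: (u, v) := egcdn m (K * d) in
  \row_(j < 3) nth 0 [:: (d * m)%:Z; - (c * (u * v)%:Z); (2 * K * (d * v) + 1)%:Z] j.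

Lemma uniq_point_pairs D : uniq (point_pairs D).
Proof.
apply: allpairs_uniq_dep => [|d _|]; rewrite ?filter_uniq ?iota_uniq //.
by move=> [d1 m1] [d2 m2] /= _ _ [-> ->].
Qed.

Lemma size_point_pairs_ge D :
  (\sum_(1 <= d < D.+1) totient d * (D ^ 2 %/ d ^ 2) <= size (point_pairs D))%N.
Proof.
rewrite size_allpairs_dep sumnE big_map /index_iota subn1.
apply: leq_sum => d _; rewrite size_filter count_coprime_iota mulnC.
by rewrite leq_mul2l leq_totientMl ?orbT // ltnW.
Qed.

Lemma mem_point_pairs D d m : (d, m) \in point_pairs D ->
  [/\ (0 < d)%N, coprime m (K * d) & (d * m <= K * D ^ 2)%N].
Proof.
case/allpairsPdep => d' [m' [+ + [-> ->]]] {d m}.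
rename d' into d, m' into m.
rewrite mem_iota mem_filter mem_iota coprime_sym => /andP[d0 _].
move=> /andP[-> /= mlt]; split=> //.
apply: leq_trans (leq_mul (leqnn d) (ltnW mlt)) _.
by rewrite mulnA (mulnCA d) -!mulnA leq_mul2l mulnA mulnn mulnC leq_divM orbT.
Qed.

(** The extended Euclidean algorithm gives v < m, and then u m = v K d + 1 <= (v + 1) K d <= m K d
    bounds u. *)
Lemma integral_pointP D dm : dm \in point_pairs D ->
  exists u v : nat, [/\ (u * dm.2 = v * (K * dm.1) + 1)%N, (v < dm.2)%N,
    (u <= K * dm.1)%N & integral_point dm = \row_(j < 3) nth 0
      [:: (dm.1 * dm.2)%:Z; - (c * (u * v)%:Z); (2 * K * (dm.1 * v) + 1)%:Z] j].
Proof.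
case: dm => d m /mem_point_pairs[d0 cop _] /=.
have Kd1 : (1 < K * d)%N by rewrite (leq_trans K_gt1) // leq_pmulr.
(* For m = 0 the gcd would be K d, which exceeds 1 because [K] does. *)
have m0 : (0 < m)%N.
  by case: m cop => //; rewrite /coprime gcd0n => /eqP E; rewrite E in Kd1.
case: (egcdnP (K * d) m0) => u v; rewrite (eqP cop) muln1 => uv vm.
exists u, v; split => //.
rewrite -(leq_pmul2r m0) uv addn1 (@leq_trans (v.+1 * (K * d))) //.
  by rewrite mulSn -add1n leq_add2r ltnW.
by rewrite mulnC leq_mul2l vm orbT.
Qed.

(** The Bezout relation makes m and v coprime, so the first and last coordinates recover d as the
    gcd of d m and d v, and then m. *)
Lemma integral_point_inj D : {in point_pairs D &, injective integral_point}.
Proof.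
have key dm : dm \in point_pairs D -> exists v : nat,
    [/\ integral_point dm 0 0 = (dm.1 * dm.2)%:Z,
        integral_point dm 0 2 = (2 * K * (dm.1 * v) + 1)%:Z &
        gcdn (dm.1 * dm.2) (dm.1 * v) = dm.1].
  move=> /integral_pointP[u [v [uv _ _ ->]]]; exists v; rewrite !mxE; split => //.
  rewrite -muln_gcdr; suff -> : gcdn dm.2 v = 1%N by rewrite muln1.
  apply/eqP; rewrite -dvdn1 -(@dvdn_addr (v * (K * dm.1))) -?uv.
    by rewrite dvdn_mull // dvdn_gcdl.
  by rewrite dvdn_mulr // dvdn_gcdr.
move=> [d m] [d' m'] h h' E.
have [v [x t g]] := key _ h; have [v' [x' t' g']] := key _ h'.
have [d0 _ _] := mem_point_pairs h.
move: x t; rewrite E x' t' /= in g g' * => -[xE] -[/eqP].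
rewrite eqn_add2r eqn_pmul2l ?muln_gt0 ?(ltnW K_gt1) // => /eqP tE.
have dE : d = d' by rewrite -g -g' xE tE.
by move: xE; rewrite -dE => /eqP; rewrite eqn_pmul2l // => /eqP ->.
Qed.

(** The ring [F] is arbitrary so that one identity serves every place. With s = d v and t = 1 + 2 K
    s, the witness [z] is s (K s + 1). *)
Lemma integral_point_eq D dm (F : comNzRingType) (a : F) : dm \in point_pairs D ->
  c%:~R = 2 * K%:R * a ->
  let w j := (integral_point dm 0 j)%:~R : F in
  a * w 2 ^+ 2 + 2 * (w 0 * w 1) = a /\
  exists z : nat, w 2 ^+ 2 - 1 = 4 * (K * z)%:R.
Proof.
move=> /integral_pointP[u [v [uv _ _ ->]]] cE w; rewrite /w !mxE /=.
have uvF : u%:R * dm.2%:R = v%:R * (K%:R * dm.1%:R) + 1 :> F.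
  by rewrite -!natrM uv natrD.
split; last first.
  exists (dm.1 * v * (K * (dm.1 * v) + 1))%N.
  by rewrite -pmulrn; rewrite !(natrM, natrD); ring.
have -> : (- (c * (u * v)%:Z))%:~R = - (2 * K%:R * a * (u * v)%:R) :> F.
  by rewrite mulrNz intrM cE pmulrn.
rewrite -!pmulrn !(natrM, natrD).
have -> : dm.1%:R * dm.2%:R * - (2 * K%:R * a * (u%:R * v%:R)) =
  - (2 * K%:R * a * v%:R * dm.1%:R * (u%:R * dm.2%:R)) by ring.
by rewrite uvF; ring.
Qed.

(** The coordinates are at most K D^2, |c| K^2 D^2 and 3 K^2 D^2, by u <= K d, v < m and d m <= K
    D^2; the 3 absorbs the final + 1. *)
Lemma integral_point_le D dm : dm \in point_pairs D ->
  (\sum_j `|integral_point dm 0%R j| <= (K + `|c| * K ^ 2 + 3 * K ^ 2) * D ^ 2)%N.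
Proof.
move=> h; have [u [v [uv vm uK ->]]] := integral_pointP h.
case: dm h uv vm uK => d m /mem_point_pairs[d0 _ dm] /= uv vm uK.
rewrite !big_ord_recl big_ord0 !mxE /= addn0 abszN abszM !absz_nat.
have m0 : (0 < m)%N by exact: leq_ltn_trans vm.
have dv : (d * v <= K * D ^ 2)%N.
  by apply: leq_trans dm; rewrite leq_mul2l (ltnW vm) orbT.
have uv' : (u * v <= K ^ 2 * D ^ 2)%N.
  apply: leq_trans (leq_mul uK (ltnW vm)) _.
  by rewrite -mulnA expnS expn1 -mulnA leq_mul2l dm orbT.
rewrite addnA (mulnDl (K + _)%N) (mulnDl K (`|c| * K ^ 2)%N).
apply: leq_add; first apply: leq_add => //.
  by rewrite -mulnA leq_mul2l uv' orbT.
have D2 : (0 < K ^ 2 * D ^ 2)%N.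
  have := leq_trans (leq_mul d0 m0) dm; rewrite muln1 muln_gt0 => /andP[_ ?].
  by rewrite muln_gt0 expn_gt0 (ltnW K_gt1).
rewrite -(mulnA 3) (mulSnr 2) leq_add // -mulnA leq_mul2l /=.
by rewrite expnS expn1 -mulnA leq_mul2l dv orbT.
Qed.
End IntegralPoints.

(** * Growth of logarithms *)

Section GrowthOfLogarithms.
Variable R : realType.

(** For a = ln (W D^2) and D >= W, one has a <= 3 ln (D + 1); since a^(1 - eps) = a / a^eps, it
    suffices that a^eps > 12 W. *)
Lemma exists_ln_dominates (W eps : R) n : 1 <= W -> 0 < eps ->
  exists2 D, (n <= D)%N & (0 < D)%N /\
    W * ln (W * D%:R ^+ 2) `^ (1 - eps) < ln D.+1%:R / 4.
Proof.
move=> W1 e0; have W0 : 0 < W by exact: lt_le_trans W1.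
(* This makes a^eps > 12 W as soon as a > M; the 12 is the 3 of the bound on a times the 4 of the
   goal. *)
pose M := (12 * W) `^ eps^-1.
pose D := (n + Num.bound W + Num.bound (expR M) + 2)%N.
exists D; first by rewrite /D -!addnA leq_addr.
have WD : W <= D%:R.
  apply: le_trans (ltW (archi_boundP (ltW W0))) _.
  by rewrite ler_nat /D -!addnA (addnCA n) leq_addr.
have MD : expR M < D%:R.
  apply: lt_le_trans (archi_boundP (expR_ge0 _)) _.
  by rewrite ler_nat /D -addnA (addnC (_ + _)%N) -addnA leq_addr.
have D1 : (1 < D)%N by rewrite /D addn2.
have D0 : 0 < D%:R :> R by rewrite ltr0n ltnW.
split; first exact: ltnW.
set a := ln _.
have aM : M < a.
  rewrite -ltr_expR lnK ?posrE ?mulr_gt0 ?exprn_gt0 //.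
  rewrite (lt_le_trans MD) // expr2 mulrA ler_peMl ?(ltW D0) //.
  by rewrite mulr_ege1 // ler1n ltnW.
have M0 : 0 < M by apply: powR_gt0; rewrite mulr_gt0 ?ltr0n.
have a0 : 0 < a by exact: lt_trans aM.
have aD : a <= 3 * ln D.+1%:R.
  have -> : 3 * ln D.+1%:R = ln (D.+1%:R ^+ 3) :> R.
    by rewrite lnXn ?ltr0n // mulr_natl.
  have DS : D%:R <= D.+1%:R :> R by rewrite ler_nat.
  rewrite ler_ln ?posrE ?mulr_gt0 ?exprn_gt0 ?ltr0n ?(ltnW D1) // (exprS D.+1%:R).
  apply: ler_pM; rewrite ?exprn_ge0 ?(ltW W0) ?(ltW D0) ?(le_trans WD DS) //.
  by rewrite lerXn2r ?nnegrE ?ler0n.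
have ae : 12 * W < a `^ eps.
  have -> : 12 * W = M `^ eps by rewrite /M -powRrM mulVf ?gt_eqF // powRr1 // mulr_ge0 ?ltW.
  by apply: gt0_ltr_powR => //; rewrite nnegrE ltW.
have ae0 : 0 < a `^ eps by exact: powR_gt0.
rewrite powRB ?(gt_eqF a0) ?implybT // powRr1 ?(ltW a0) // mulrA ltr_pdivrMr //.
have : 12 * W * a < a `^ eps * a by rewrite ltr_pM2r.
have : a `^ eps * a <= a `^ eps * (3 * ln D.+1%:R) by rewrite ler_pM2l.
by move: (ln _) => l; lra.
Qed.

End GrowthOfLogarithms.

(** * The p-adic norm and p-adic balls *)

Section PadicNormTheory.
Variables (R : realType) (p : nat).
Local Notation norm := (@padic_norm R p).

Lemma padic_normM x y : norm (x * y) = norm x * norm y.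
Proof.
rewrite -[x]reprK -[y]reprK -rmorphM.
have := cvgM (@padic_norm_cvg R p (repr x)) (@padic_norm_cvg R p (repr y)).
have := @padic_norm_cvg R p (repr x * repr y).
rewrite (_ : (fun n => ratr _) =
  (fun n => ratr (padic_abs p (repr x n)) * ratr (padic_abs p (repr y n)))); last first.
  by apply/funext => n; rewrite -rmorphM -padic_absM.
by move=> h1 h2; exact: (cvg_unique (@norm_hausdorff _ _) h1 (h2 _)).
Qed.

Lemma padic_normD x y : norm (x + y) <= Num.max (norm x) (norm y).
Proof.
rewrite -[x]reprK -[y]reprK -rmorphD.
have hxy := @padic_norm_cvg R p (repr x + repr y).
have hx := @padic_norm_cvg R p (repr x); have hy := @padic_norm_cvg R p (repr y).
(* The slack [e] puts both sequences of absolute values strictly below the bound from some rank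
   on. *)
set M := Num.max _ _; apply/ler_addgt0Pr => e e0.
rewrite -(cvg_lim _ hxy) //; apply: limr_le.
  by apply/cvg_ex; exists (norm (\pi_(padic p)%qT (repr x + repr y))).
have ltM z : z <= M -> z < M + e by move=> zM; rewrite (le_lt_trans zM) // ltrDl.
near=> n.
apply: (@le_trans _ _ (ratr (Num.max (padic_abs p (repr x n)) (padic_abs p (repr y n))))).
  by rewrite ler_rat padic_absD.
rewrite maxEle; case: ifP => _; apply: ltW; near: n.
  by apply: cvgr_lt hy _ (ltM _ _); rewrite le_max lexx orbT.
by apply: cvgr_lt hx _ (ltM _ _); rewrite le_max lexx.
Unshelve. all: by end_near. Qed.

Lemma padic_norm_ge0 x : 0 <= norm x.
Proof.
rewrite -[x]reprK -(cvg_lim _ (@padic_norm_cvg R p (repr x))) //.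
apply: limr_ge; first exact: padic_seq_cvgn.
by near=> n; rewrite ler0q padic_abs_ge0.
Unshelve. all: by end_near. Qed.

Lemma padic_norm_int_le1 (z : int) : norm z%:~R <= 1.
Proof.
rewrite -(ratr_int _ z) padic_norm_ratr -(rmorph1 (@ratr R)) ler_rat.
have [->|z0] := eqVneq z 0; first by rewrite padic_abs0.
rewrite -[z%:~R]divr1 -[1]/(1%:~R) padic_abs_frac // logn1 sub0r.
have [pp|np] := boolP (prime p); last by rewrite lognE (negPf np) expr0z.
by rewrite -exprnN invf_le1 ?exprn_ege1 ?exprn_gt0 ?ler1n ?ltr0n ?prime_gt0.
Qed.

Lemma padic_norm1 : norm 1 = 1.
Proof.
by have := @padic_norm_ratr R p 1; rewrite padic_abs1 (ratr_nat (padic p) 1) (ratr_nat R 1).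
Qed.

Hypothesis p_prime : prime p.

Lemma padic_norm_prime : norm p%:R = p%:R^-1.
Proof.
have p0 : p%:Z != 0 by rewrite -lt0n prime_gt0.
have E : padic_abs p p%:R = p%:R^-1.
  have := @padic_abs_frac p p%:Z 1 p0 isT; rewrite divr1 => ->.
  by rewrite logn1 absz_nat logn_prime // eqxx sub0r exprN1.
by rewrite -(ratr_nat (padic p) p) padic_norm_ratr E -[in RHS](ratr_nat R p) fmorphV.
Qed.

Lemma padic_norm_small_multiple x : exists m : nat,
  forall z : int, norm (x * p%:R ^+ m * z%:~R) <= 1.
Proof.
have p0 : 0 < p%:R :> R by rewrite ltr0n prime_gt0.
(* This exponent is large enough because p^m > m > |x|. *)
exists (Num.bound (norm x)) => z; set m := Num.bound _.
rewrite padic_normM -[leRHS]mulr1 ler_pM ?padic_norm_int_le1 ?padic_norm_ge0 //.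
rewrite padic_normM.
have -> : norm (p%:R ^+ m) = p%:R ^- m.
  elim: (m) => [|k IHk]; first by rewrite !expr0 padic_norm1 invr1.
  by rewrite !exprS padic_normM IHk padic_norm_prime invfM.
rewrite ler_pdivrMr ?exprn_gt0 // mul1r.
apply: le_trans (ltW (archi_boundP (padic_norm_ge0 x))) _.
by rewrite -natrX ler_nat ltnW // ltn_expl // prime_gt1.
Qed.
End PadicNormTheory.

(** A ball absorbs every perturbation divisible by a high enough power of p. The centre has to be
    nonzero to serve as a coefficient of a non-degenerate form, so a = 0 is replaced by p^b, a point
    of the same ball. *)
Lemma padic_ball_center (R : realType) (p : nat) (a : padic p) (b : int) :
  prime p ->
  exists2 alpha : padic p, alpha != 0 & forall x, exists m : nat, forall z : int,
    [set a + p%:R ^ b * z | z in [set z | padic_norm R z <= 1]]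
      (alpha + x * p%:R ^+ m * z%:~R).
Proof.
move=> p_prime.
have p0 : p%:R != 0 :> padic p.
  by have := @padic_intr_eq0 p p%:Z; rewrite -pmulrn => ->; rewrite -lt0n prime_gt0.
have pb0 : p%:R ^ b != 0 :> padic p by rewrite expfz_neq0.
pose e : int := a == 0.
exists (a + p%:R ^ b * e%:~R).
  rewrite /e; have [->|a0] := eqVneq a 0; first by rewrite add0r mulr1.
  by rewrite mulr0 addr0.
move=> x; have [m hm] := padic_norm_small_multiple R p_prime (x / p%:R ^ b).
exists m => z; exists (e%:~R + x / p%:R ^ b * p%:R ^+ m * z%:~R).
  by apply: le_trans (padic_normD _ _ _) _; rewrite ge_max padic_norm_int_le1 hm.
rewrite mulrDr addrA; congr (_ + _).
by rewrite !mulrA (mulrC _ x) mulfK.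
Qed.

(** * Finiteness of the counted set *)

Lemma finite_set_row (T : choiceType) n (G : set T) :
  finite_set G -> finite_set [set x : 'rV[T]_n | forall j, G (x 0 j)].
Proof.
move=> finG.
pose row_of (f : {ffun 'I_n -> fset_set G}) : 'rV[T]_n := \row_j fsval (f j).
apply: (@sub_finite_set _ _ (range row_of)); last exact: finite_image.
move=> x Gx.
have xG j : x 0 j \in fset_set G by rewrite in_fset_set // inE.
exists [ffun j => FSetSub (xG j)] => //.
by apply/rowP => j; rewrite !mxE ffunE.
Qed.

(** Multiplication by [N] sends these rationals injectively to integers of absolute value at most B
    N. *)
Lemma finite_rat_bounded_denominator (R : realType) (N : nat) (B : R) : (0 < N)%N ->
  finite_set [set x : rat | (`|denq x| %| N)%N /\ `|ratr x : R| <= B].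
Proof.
move=> N0; pose M := (Num.bound (B * N%:R)).+1.
apply: (@sub_finite_set _ _ ([set z%:~R / N%:R | z in
   (Posz @` `I_M) `|` ((fun n => - Posz n) @` `I_M)])); last first.
  by apply/finite_image; rewrite finite_setU; split; apply: finite_image; exact: finite_II.
move=> x /= [/dvdnP[k Nk] xB].
have d0 : (denq x)%:~R != 0 :> rat by rewrite intr_eq0 denq_neq0.
have NE : N%:R = k%:R * (denq x)%:~R :> rat.
  rewrite -[denq x]gez0_abs ?denq_ge0 // Nk natrM.
  by [].
have xN : (numq x * k)%:~R = x * N%:R :> rat.
  by rewrite NE intrM numqE -pmulrn mulrA (mulrAC x) mulrC mulrA.
have NQ : N%:R != 0 :> rat by rewrite pnatr_eq0 -lt0n.
exists (numq x * k); last by rewrite xN mulfK.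
have zM : (`|(numq x * k)%R| < M)%N.
  have zB : `|(numq x * k)%:~R : R| <= B * N%:R.
    rewrite -(ratr_int R) xN rmorphM /= ratr_nat normrM (ger0_norm (ler0n _ _)).
    by rewrite ler_wpM2r ?ler0n.
  have B0 : 0 <= B * N%:R by exact: le_trans zB.
  rewrite /M ltnS ltnW // -(ltr_nat R) natr_absz intr_norm.
  exact: le_lt_trans zB (archi_boundP B0).
case: (numq x * k) zM => n nM; first by left; exists n.
by right; exists n.+1; rewrite // NegzE.
Qed.

Section SArithmeticPoints.
Variables (R : realType) (Sf : {fset nat}).
Hypothesis Sf_prime : forall p, p \in Sf -> prime p.

(** If a prime p has exponent k > 0 in the denominator, then |x|_p = p^k: S-integrality excludes
    this outside [Sf], and inside [Sf] the bound gives k <= i. *)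
Lemma denq_dvdn_prod (x : rat) i : S_integral Sf x ->
  (forall p, p \in Sf -> padic_abs p x <= p%:R ^+ i) ->
  (`|denq x| %| (\prod_(p <- Sf) p) ^ i)%N.
Proof.
move=> Sx xi; have d0 : (0 < `|denq x|)%N by rewrite absz_gt0 denq_neq0.
have N0 : (0 < \prod_(p <- Sf) p)%N.
  by rewrite big_seq prodn_cond_gt0 // => p /Sf_prime/prime_gt0.
apply/(dvdn_partP _ d0) => p; rewrite mem_primes => /and3P[pp _ pd].
have absE : padic_abs p x = p%:R ^+ logn p `|denq x|.
  have num0 : logn p `|numq x| = 0%N.
    apply/eqP; rewrite -leqn0 leqNgt logn_gt0 mem_primes pp /=.
    apply/negP => /andP[_ pn]; have := dvdn_gcd p `|numq x| `|denq x|.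
    by rewrite pn pd (eqP (coprime_num_den x)) dvdn1 => /eqP p1; rewrite p1 in pp.
  rewrite /padic_abs num0 subr0; case: eqP => // x0.
  by move: pd; rewrite x0 dvdn1 => /eqP p1; rewrite p1 in pp.
have p1 : 1 < p%:R :> rat by rewrite ltr1n prime_gt1.
rewrite p_part; have [pS|pS] := boolP (p \in Sf); last first.
  have := Sx p pp pS; rewrite absE -(expr0 p%:R) ler_eXn2l // leqn0 => /eqP ->.
  by rewrite dvd1n.
have := xi p pS; rewrite absE ler_eXn2l // => li.
apply: (dvdn_trans (dvdn_exp2l p li)); apply: dvdn_exp2r.
by rewrite (big_fsetD1 p) //= dvdn_mulr.
Qed.

Lemma dilate_entry_le n (T : place Sf -> R) v (y : 'rV_n) j : 0 <= T v ->
  dilate T (unit_balls R Sf n) v y -> place_abs v (y 0 j) <= T v.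
Proof.
case: v y => [p|] y T0 [z [w [zT + ->]]] /=; rewrite mxE => wle.
  rewrite padic_normM -[leRHS]mulr1 ler_pM ?padic_norm_ge0 //.
  by apply: le_trans wle; apply: (le_bigmax _ (fun j => padic_norm R (w 0 j))).
rewrite normrM -[leRHS]mulr1 ler_pM //.
apply: le_trans wle; rewrite -sqrtr_sqr ler_wsqrtr // (bigD1 j) //= lerDl.
by rewrite sumr_ge0 // => k _; rewrite sqr_ge0.
Qed.

(** As [fset_set] is empty on infinite sets, a lower bound for [S_count] requires finiteness. The
    finite places bound the denominators, the real place the size. *)
Lemma finite_S_integral_dilate n (T : place Sf -> R) i : (forall v, 0 <= T v) ->
  (forall p : Sf, T (Some p) <= (fsval p)%:R ^+ i) ->
  finite_set [set x : 'rV[rat]_n | (forall j, S_integral Sf (x 0 j)) /\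
    (forall v, dilate T (unit_balls R Sf n) v (map_mx ratr x))].
Proof.
move=> T0 Ti.
have N0 : (0 < (\prod_(p <- Sf) p) ^ i)%N.
  rewrite expn_gt0 big_seq prodn_cond_gt0 // => p /Sf_prime/prime_gt0 //.
apply: sub_finite_set (finite_set_row n (finite_rat_bounded_denominator (T None) N0)).
move=> x [Sx xT] j; split; last first.
  by have := dilate_entry_le j (T0 None) (xT None); rewrite /= mxE.
apply: denq_dvdn_prod (Sx j) _ => p pS.
have := dilate_entry_le j (T0 _) (xT (Some [` pS]%fset)).
rewrite /= mxE padic_norm_ratr => /le_trans/(_ (Ti _)) /=.
by rewrite -(ratr_nat R) -rmorphXn ler_rat.
Qed.

Lemma S_integral_int (z : int) : S_integral Sf z%:~R.
Proof.
move=> l _ _; have := padic_norm_int_le1 R l z.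
by rewrite -(ratr_int (padic l)) padic_norm_ratr -(rmorph1 (@ratr R)) ler_rat.
Qed.

End SArithmeticPoints.

(** * The split ternary form *)

Section SplitForm.
Variables (F : fieldType) (a : F).

(* The Gram matrix of 2 x y + a t^2 in the coordinates (x, y, t). *)
Definition split_gram : 'M[F]_3 := \matrix_(i, j)
  if (i + j == 1)%N then 1 else if (i + j == 4)%N then a else 0.

Fact split_gram_sym : split_gram \is symmetricmx.
Proof.
apply/is_hermitianmxP/matrixP => i j.
by rewrite expr0 scale1r !mxE /= addnC.
Qed.

Definition split_form := QuadraticForm split_gram_sym.

Lemma split_form_bilin u v : qf_bilin split_form u v =
  u 0 0 * v 0 1 + u 0 1 * v 0 0 + a * (u 0 2 * v 0 2).
Proof.
rewrite /qf_bilin !mxE !big_ord_recl big_ord0 !mxE.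
rewrite !big_ord_recl !big_ord0 !mxE /=.
rewrite !(mulr0, mulr1, add0r, addr0).
have -> : lift ord0 ord0 = 1 :> 'I_3 by exact/val_inj.
have -> : lift ord0 (lift ord0 ord0) = 2 :> 'I_3 by exact/val_inj.
have -> : ord0 = 0 :> 'I_3 by exact/val_inj.
by rewrite addrA [u 0 1 * _ + _]addrC mulrA (mulrC a).
Qed.

Lemma split_form_eval v :
  qf_eval split_form v = a * v 0 2 ^+ 2 + 2 * (v 0 0 * v 0 1).
Proof. by rewrite /qf_eval split_form_bilin; ring. Qed.

Lemma split_form_nondegenerate : a != 0 -> qf_nondegenerate split_form.
Proof.
move=> a0 u u0; apply/rowP => j; rewrite mxE.
have uE k : qf_bilin split_form u (delta_mx 0 k) = 0 by exact: u0.
have := uE 1; have := uE 0; have := uE 2; rewrite !split_form_bilin !mxE /=.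
rewrite !(mulr0, mulr1, add0r, addr0) => /eqP; rewrite mulf_eq0 (negPf a0) => /eqP h2 h1 h0.
by case: j => [[|[|[|//]]] hj]; [rewrite -h0|rewrite -h1|rewrite -h2]; congr (u _ _); exact: val_inj.
Qed.

Lemma split_form_isotropic : qf_isotropic split_form.
Proof.
exists (delta_mx 0 0); last by rewrite split_form_eval !mxE /= expr0n !(mulr0, addr0).
by apply/eqP => /rowP/(_ 0); rewrite !mxE => /eqP; rewrite oner_eq0.
Qed.

End SplitForm.

(** At the real place the ratio of the (t, t) and (x, y) Gram entries is [alpha None]. Scaling by
    [lambda] preserves this ratio, so rationality of the form would make it rational. *)
Lemma split_form_irrational (R : realType) (Sf : {fset nat})
    (alpha : forall v : place Sf, completion R v) :
  (forall x : rat, alpha None != ratr x) ->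
  ~ S_rational (fun v => split_form (alpha v)).
Proof.
move=> irr [q0 [lambda [lambda0 /(_ None) gE]]].
have [l [l0 e1 e2]] : exists l : R, [/\ l != 0, 1 = l * ratr (gram q0 0 1) &
    alpha None = l * ratr (gram q0 2 2)].
  have /matrixP gE' := gE; exists (lambda None); split; first exact: lambda0.
    by have := gE' 0 1; rewrite !mxE.
  by have := gE' 2 2; rewrite !mxE.
have /eqP := irr (gram q0 2 2 / gram q0 0 1); apply.
rewrite e2 rmorphM fmorphV mulrC; congr (_ * _).
have g0 : ratr (gram q0 0 1) != 0 :> R.
  by apply: contra_eq_neq e1 => ->; rewrite mulr0 oner_neq0.
by apply: (mulIf g0); rewrite mulVf.
Qed.

(** * Lower bounds from distinct integer vectors *)

Section SCountLowerBound.
Variables (R : realType) (Sf : {fset nat}).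
Hypothesis Sf_prime : forall p, p \in Sf -> prime p.

Lemma dilate_int n (T : place Sf -> R) v (w : 'rV[int]_n) :
  (forall p : Sf, 1 <= T (Some p)) ->
  0 < T None -> (\sum_j `|w 0%R j|)%N%:R <= T None ->
  dilate T (unit_balls R Sf n) v (map_mx intr w).
Proof.
move=> Tp T0 wT; case: v => [p|].
  exists 1, (map_mx intr w); rewrite scale1r; split=> //=.
    by rewrite padic_norm1.
  by apply: bigmax_le => // j _; rewrite mxE padic_norm_int_le1.
exists (T None), ((T None)^-1 *: map_mx intr w); split => /=.
- by rewrite ger0_norm // ltW.
- rewrite /unit_balls /= -[leRHS]sqrtr1 ler_wsqrtr //.
  (* Each entry is then at most 1 in absolute value, so its square is no larger, and the squared
     Euclidean norm is at most this sum. *)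
  have E : \sum_j `|(w 0 j)%:~R / T None| <= 1.
    under eq_bigr do rewrite normrM normfV (gtr0_norm T0).
    rewrite -mulr_suml ler_pdivrMr // mul1r; apply: le_trans wT.
    by rewrite natr_sum ler_sum // => j _; rewrite natr_absz intr_norm.
  apply: le_trans (E); apply: ler_sum => j _; rewrite !mxE mulrC.
  rewrite -real_normK ?num_real // expr2 ler_piMl //; apply: le_trans E.
  by rewrite (bigD1 j) //= lerDl sumr_ge0.
- by rewrite scalerA divff ?scale1r // gt_eqF.
Qed.

(** The form T_p = p^i gives T_p >= 1, which puts integer vectors in the dilate at p, and also the
    bound on denominators behind finiteness. *)
Lemma S_count_ge n (I : forall v : place Sf, set (completion R v)) (q : S_form R Sf n)
    (T : place Sf -> R) i (s : seq 'rV[int]_n) :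
  0 < T None -> (forall p : Sf, T (Some p) = (fsval p)%:R ^+ i) -> uniq s ->
  (forall w, w \in s -> (\sum_j `|w 0%R j|)%N%:R <= T None) ->
  (forall w v, w \in s -> I v (qf_eval (q v) (map_mx intr w))) ->
  (size s <= S_count I q (unit_balls R Sf n) T)%N.
Proof.
move=> T0 Tp us sT sI.
have Tp1 (p : Sf) : 1 <= T (Some p).
  by rewrite Tp exprn_ege1 // ler1n prime_gt0 // Sf_prime // fsvalP.
pose f (w : 'rV[int]_n) : 'rV[rat]_n := map_mx intr w.
have f_inj : injective f.
  by move=> w w' /rowP E; apply/rowP => j; have := E j; rewrite !mxE => /eqP; rewrite eqr_int => /eqP.
rewrite -(size_map f) uniq_leq_size ?map_inj_uniq // => x /mapP[w ws ->].
rewrite in_fset_set.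
  rewrite inE /=; split=> [j|v]; first by rewrite mxE; exact: (S_integral_int R).
  have -> : map_mx ratr (f w) = map_mx intr w :> 'rV[completion R v]_n.
    by apply/rowP => j; rewrite !mxE ratr_int.
  by split; [exact: dilate_int (sT w ws)|exact: sI].
apply: sub_finite_set (@finite_S_integral_dilate R Sf Sf_prime n T i _ _).
- by move=> y [yS yD]; split=> // v; have [] := yD v.
- by case=> [p|]; [apply: le_trans (Tp1 p)|exact: ltW].
- by move=> p; rewrite Tp.
Qed.

End SCountLowerBound.

(** * Many points when the real coefficient is near a rational *)

Section NearRational.
Variables (R : realType) (Sf : {fset nat}).
Hypothesis Sf_prime : forall p, p \in Sf -> prime p.
Variable I : forall v : place Sf, set (completion R v).
Arguments I : clear implicits.
Variable alphap : forall p : Sf, padic (fsval p).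
Hypothesis alphapP : forall (p : Sf) x, exists m : nat, forall z : int,
  I (Some p) (alphap p + x * (fsval p)%:R ^+ m * z%:~R).
Variables (lo hi : R).
Hypothesis I_real : forall x : R, lo < x -> x < hi -> I None x.
Variable eps : R.
Hypothesis eps_gt0 : 0 < eps.

Definition split_coef (alpha : R) (v : place Sf) : completion R v :=
  match v with None => alpha | Some p => alphap p end.

Definition split_S_form alpha : S_form R Sf 3 := fun v => split_form (split_coef alpha v).

(** The index [i] is the exponent at all finite places and a lower bound at the real one, so every
    component grows with it. *)
Definition many_points i alpha := exists T : place Sf -> R,
  [/\ i%:R <= T None, 0 < T None, forall p : Sf, T (Some p) = (fsval p)%:R ^+ i &
      S_time_norm T * ln (S_time_norm T) `^ (1 - eps) <
      (S_count I (split_S_form alpha) (unit_balls R Sf 3) T)%:R].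

(** The integer points are built for [a] and, like the time, do not depend on [alpha]; the radius is
    chosen after them. *)
Lemma many_points_near_rational i (a : rat) : lo < ratr a < hi ->
  exists2 r, 0 < r & forall alpha, `|alpha - ratr a| < r -> many_points i alpha.
Proof.
move=> /andP[loa ahi].
have /choice[m mP] : forall p : Sf, exists m : nat, forall z : int,
    I (Some p) (alphap p + (alphap p - ratr a) * (fsval p)%:R ^+ m * z%:~R).
  by move=> p; exact: alphapP.
pose P := (\prod_(p : Sf) fsval p ^ m p)%N.
have P0 : (0 < P)%N.
  by apply: prodn_gt0 => p; rewrite expn_gt0 prime_gt0 // Sf_prime // fsvalP.
(* The denominator makes c = 2 K a an integer, [P] supplies the power of each finite p, and the
   factor 2 ensures K > 1. *)
pose K := (2 * (`|denq a| * P))%N.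
have K1 : (1 < K)%N by rewrite leq_pmulr // muln_gt0 absz_gt0 denq_neq0.
pose c : int := 4 * (numq a * P%:Z).
have cE (F : unitRingType) : ((denq a)%:~R : F) \is a GRing.unit ->
    c%:~R = 2 * K%:R * ratr a :> F.
  move=> da; rewrite /ratr mulrA; apply: (canRL (mulrK da)).
  have H : c * denq a = 2 * K%:Z * numq a.
    by rewrite /c /K !PoszM gez0_abs ?denq_ge0 //; ring.
  by rewrite (pmulrn 1 K) -[2]/(2%:~R) -!intrM H.
pose E := (K + `|c| * K ^ 2 + 3 * K ^ 2)%N.
have E0 : (0 < E)%N by rewrite /E -addnA ltn_addr // ltnW.
pose Tf : place Sf -> R := fun v => if v is Some p then (fsval p)%:R ^+ i else 0.
(* [W] gathers the size constant [E] and the finite components. It is fixed before [D], and the norm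
   of the time will be W D^2. *)
pose W : R := E%:R * \prod_(v : place Sf | v != None) Tf v.
have Tf1 (p : Sf) : 1 <= Tf (Some p).
  by rewrite exprn_ege1 // ler1n prime_gt0 // Sf_prime // fsvalP.
have W1 : 1 <= W.
  rewrite mulr_ege1 ?ler1n //.
  elim/big_ind: _ => // [x y x1 y1|[p|//] _]; first by rewrite mulr_ege1.
  exact: Tf1.
have [D iD [D0 WD]] := exists_ln_dominates i W1 eps_gt0.
pose T0 : R := (E * D ^ 2)%:R.
pose T (v : place Sf) : R := if v is Some p then (fsval p)%:R ^+ i else T0.
have T00 : 0 < T0 by rewrite ltr0n muln_gt0 E0 expn_gt0 D0.
have TW : S_time_norm T = W * D%:R ^+ 2.
  rewrite /S_time_norm (bigD1 None) //= (eq_bigr Tf); last by case.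
  by rewrite /T0 natrM natrX mulrAC.
pose delta := Num.min (ratr a - lo) (hi - ratr a).
have delta0 : 0 < delta by rewrite lt_min !subr_gt0 loa.
have T01 : 0 < T0 ^+ 2 + 1 by rewrite ltr_wpDl ?sqr_ge0.
(* All points have |t| <= T0, so the real value a + (alpha - a) t^2 stays within [delta] of a, hence
   between [lo] and [hi]. *)
exists (delta / (T0 ^+ 2 + 1)); first by rewrite divr_gt0.
move=> alpha alphaa; exists T; split=> //.
  by rewrite ler_nat (leq_trans iD) // (leq_trans _ (leq_pmull _ E0)) // -{1}[D]expn1 leq_pexp2l.
pose s := [seq integral_point K c dm | dm <- point_pairs K D].
have us : uniq s.
  by rewrite map_inj_in_uniq ?uniq_point_pairs //; exact: integral_point_inj.
apply: (@lt_le_trans _ _ (size s)%:R).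
  rewrite TW size_map; apply: (@lt_le_trans _ _ (D%:R ^+ 2 * ln D.+1%:R / 4)).
    by rewrite mulrAC mulrC -[ltRHS]mulrA ltr_pM2l ?exprn_gt0 ?ltr0n.
  apply: le_trans (sum_totient_divn_ge R D) _.
  by rewrite ler_nat size_point_pairs_ge // ltnW.
rewrite ler_nat; apply: (@S_count_ge _ _ Sf_prime _ _ _ _ i) => //.
  move=> w /mapP[dm dmD ->]; rewrite ler_nat.
  exact: integral_point_le dmD.
move=> w [p|] /mapP[dm dmD ->]; rewrite split_form_eval !mxE /=.
  have a_p : ((denq a)%:~R : padic (fsval p)) \is a GRing.unit.
    by rewrite unitfE padic_intr_eq0 denq_neq0.
  have [aE [z zE]] := integral_point_eq K1 dmD (cE _ a_p).
  have [k kE] : exists k : nat, K = (k * fsval p ^ m p)%N.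
    exists (2 * `|denq a| * \prod_(j | j != p) fsval j ^ m j)%N.
    by rewrite /K /P (bigD1 p) //= mulnA mulnCA mulnC.
  (* By a t^2 + 2 x y = a the value is alpha_p + (alpha_p - a) (t^2 - 1), and t^2 - 1 = 4 K z is a
     multiple of p^(m p). *)
  suff -> : alphap p * (integral_point K c dm 0 2)%:~R ^+ 2 + 2 *
      ((integral_point K c dm 0 0)%:~R * (integral_point K c dm 0 1)%:~R) =
      alphap p + (alphap p - ratr a) * (fsval p)%:R ^+ m p * (4 * k * z)%:Z%:~R.
    exact: mP.
  rewrite -[X in _ = _ + X]mulrA.
  have -> : (fsval p)%:R ^+ m p * (4 * k * z)%:Z%:~R =
      (integral_point K c dm 0 2)%:~R ^+ 2 - 1 :> padic (fsval p).
    by rewrite zE -pmulrn {1}kE !natrM natrX; ring.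
  rewrite (canRL (addKr _) aE); ring.
have a_r : ((denq a)%:~R : R) \is a GRing.unit by rewrite unitfE intr_eq0 denq_neq0.
have [aE _] := integral_point_eq K1 dmD (cE _ a_r).
have tT : `|(integral_point K c dm 0 2)%:~R : R| <= T0.
  rewrite -intr_norm -natr_absz ler_nat; apply: leq_trans (integral_point_le c K1 dmD).
  by rewrite (bigD1 2) //= leq_addr.
rewrite (canRL (addKr _) aE); move: (_%:~R) tT => t tT.
have t2 : t ^+ 2 <= T0 ^+ 2 by rewrite -real_normK ?num_real // lerXn2r ?nnegrE ?(ltW T00).
have close : `|(alpha - ratr a) * t ^+ 2| < delta.
  rewrite normrM (ger0_norm (sqr_ge0 t)).
  apply: (@le_lt_trans _ _ (`|alpha - ratr a| * (T0 ^+ 2 + 1))).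
    by rewrite ler_wpM2l // (le_trans t2) // lerDl.
  by rewrite -ltr_pdivlMr.
have -> : alpha * t ^+ 2 + (- (ratr a * t ^+ 2) + ratr a) =
  ratr a + (alpha - ratr a) * t ^+ 2 by ring.
move: close; rewrite lt_min !ltr_norml => /andP[/andP[h1 _] /andP[_ h2]].
by apply: I_real; lra.
Qed.
End NearRational.

(** * An irrational coefficient by Baire category *)

Lemma rat_between_neq (R : realType) (l u : R) (c : option rat) : l < u ->
  exists2 a : rat, l < ratr a < u & c != Some a.
Proof.
move=> lu; have [a] := rat_in_itvoo lu; rewrite in_itv /= => /andP[la au].
have [b] := rat_in_itvoo au; rewrite in_itv /= => /andP[ab bu].
have [ca|ca] := eqVneq c (Some a); last by exists a => //; rewrite la.
exists b; first by rewrite (lt_trans la ab).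
by rewrite ca; apply: contraTneq ab => -[->]; rewrite ltxx.
Qed.

(** Stage i of a Baire argument imposes [P i] and also excludes the rational with code i, so a point
    common to all stages is irrational. *)
Lemma exists_irrational_near_rationals (R : realType) (lo hi : R)
    (P : nat -> R -> Prop) : lo < hi ->
  (forall i (a : rat), lo < ratr a < hi ->
     exists2 r, 0 < r & forall x, `|x - ratr a| < r -> P i x) ->
  exists x, [/\ lo < x < hi, forall a : rat, x != ratr a & forall i, P i x].
Proof.
move=> lohi Pnear.
pose Q i x := P i x /\ forall a : rat, choice.unpickle i = Some a -> x != ratr a.
(* The condition bears only on the interval, which makes this open set dense in the whole line, as
   [Baire] requires. *)
pose F i := [set x : R | lo < x < hi -> Q i x]°.
have Fdense i : open (F i) /\ dense (F i).
  split; first exact: open_interior.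
  move=> O [x0 Ox0] oO.
  have [e e0 eO] : exists2 e : R, 0 < e & forall y, `|y - x0| < e -> O y.
    have /nbhs_ballP[e /= e0 eO] := open_nbhs_nbhs (conj oO Ox0).
    by exists e => // y yx; apply: eO; rewrite /ball /= distrC.
  (* If the ball around [x0] misses the interval, the condition is vacuous there and [x0] itself is
     interior. *)
  have [disj|meet] := leP (Num.min (x0 + e) hi) (Num.max (x0 - e) lo).
    exists x0; split=> //; apply/nbhs_ballP; exists e => //= y.
    rewrite /ball /= distrC ltr_distl => /andP[y1 y2] /andP[y3 y4].
    suff : y < y by rewrite ltxx.
    apply: (@lt_le_trans _ _ (Num.min (x0 + e) hi)); first by rewrite lt_min y2.
    by rewrite (le_trans disj) // ge_max !ltW.
  have [a] := rat_between_neq (choice.unpickle i) meet.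
  rewrite gt_max lt_min => /andP[/andP[a1 a2] /andP[a3 a4]] ai.
  have [|r r0 rP] := Pnear i a; first by rewrite a2.
  exists (ratr a); split; first by apply: eO; rewrite ltr_distl a1.
  have [s s0 sQ] : exists2 s : R, 0 < s & forall y, `|y - ratr a| < s ->
      forall b : rat, choice.unpickle i = Some b -> y != ratr b.
    case: (choice.unpickle i) ai => [b ab|_]; last by exists 1.
    exists `|ratr b - ratr a| => [|y ya _ [<-]].
      by rewrite normr_gt0 subr_eq0 fmorph_eq; apply: contraNneq ab => ->.
    by apply: contraTneq ya => ->; rewrite ltxx.
  apply/nbhs_ballP; exists (Num.min r s) => [|y]; first by rewrite /= lt_min r0.
  rewrite /ball /= distrC lt_min => /andP[yr ys] _.
  by split; [exact: rP|exact: sQ].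
have oI : open (`]lo, hi[%classic : set R) by exact: interval_open.
have [|x [/= xI xF]] := Baire Fdense _ oI.
  exists ((lo + hi) / 2); rewrite /= in_itv /=; apply/andP; split; lra.
rewrite in_itv /= in xI.
have xQ i : Q i x by have /nbhs_singleton := xF i I; apply.
exists x; split=> // [a|i]; last by have [] := xQ i.
by have [_] := xQ (choice.pickle a); apply; rewrite choice.pickleK.
Qed.

(** * Assembly of the form and the times *)

Theorem theorem1p9 (R : realType) (Sf : {fset nat})
    (Sf_odd_prime : forall p, p \in Sf -> prime p /\ odd p)
    (I : forall v : place Sf, set (completion R v)) (I_interval : S_interval I)
    (eps : R) (eps_gt0 : 0 < eps) :
  exists (q : S_form R Sf 3) (c : R) (T : nat -> place Sf -> R),
    [/\ S_nondegenerate q, S_isotropic q & ~ S_rational q] /\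
    0 < c /\
    (forall i, S_time (T i)) /\
    (forall v, T ^~ v @ \oo --> +oo) /\
    (forall i, c * S_time_norm (T i) * ln (S_time_norm (T i)) `^ (1 - eps)
               < (S_count I q (unit_balls R Sf 3) (T i))%:R).
Proof.
have Sf_prime p : p \in Sf -> prime p by move=> /Sf_odd_prime[].
have Sfp (p : Sf) : prime (fsval p) by exact: Sf_prime (fsvalP p).
have exalpha (p : Sf) : exists alpha : padic (fsval p), alpha != 0 /\
    forall x, exists m : nat, forall z : int,
      I (Some p) (alpha + x * (fsval p)%:R ^+ m * z%:~R).
  have [a [b ->]] := I_interval (Some p).
  by have [alpha] := padic_ball_center R a b (Sfp p); exists alpha.
pose alphap p := sval (cid (exalpha p)); have alphapP p := svalP (cid (exalpha p)).
have [lo [hi [lohi I_real]]] : exists lo hi : R, lo < hi /\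
    forall x : R, lo < x -> x < hi -> I None x.
  have [b1 [b2 [lo [hi [lohi ->]]]]] := I_interval None.
  exists lo, hi; split=> // x xlo xhi /=.
  by case: b1 b2 => [] []; rewrite in_itv /= ?xlo ?xhi ?ltW.
have near_rat i a := many_points_near_rational Sf_prime
  (fun p => (alphapP p).2) I_real eps_gt0 i (a := a).
have [alpha [_ alpha_irr alphaP]] := exists_irrational_near_rationals lohi near_rat.
have [T TP] := choice alphaP.
(* The constant can be 1, since each stage has already absorbed the others into the logarithm. *)
exists (split_S_form alphap alpha), 1, T; do !split => //.
- move=> v; apply: split_form_nondegenerate; case: v => [p|]; first by case: (alphapP p).
  by have := alpha_irr 0; rewrite rmorph0.
- by move=> v; exact: split_form_isotropic.
- exact: split_form_irrational.
- by case=> [p|]; have [_ T0 Tp _] := TP i; rewrite ?Tp // exprn_gt0 // ltr0n prime_gt0.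
- by move=> p; exists i%:Z; have [_ _ -> _] := TP i.
(* Every component is at least i: by construction at the real place, by p^i > i at a finite one. *)
- move=> v; apply/cvgryPge => A; near=> i.
  apply: (@le_trans _ _ i%:R).
    near: i. exact: nbhs_infty_ger.
  case: v => [p|]; have [Ti _ Tp _] := TP i => //.
  by rewrite Tp -natrX ler_nat ltnW // ltn_expl // prime_gt1.
- by move=> i; rewrite mul1r; have [] := TP i.
Unshelve. all: by end_near. Qed.
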